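(* Let $X$ be a non-trivial real Hausdorff locally convex space with topological dual $X^*$. For every $C\subset X$ and every $(x,x^* )\in X\times X^*$, $$\varphi_{N_C}(x,x^* )=\iota_{C^{\#}}(x)+\sigma_C(x^* ).$$ In particular, for every $\emptyset\neq C\subset X$ and every $(x,x^* )\in X\times X^*$, one has $\varphi_{N_C}(x,0)=\iota_{C^{\#}}(x)\ge 0$, $\varphi_{N_C}(x,x^* )\le \iota_C(x)+\sigma_C(x^* )$, and $$C^{\#}=\operatorname{Pr}_X(\operatorname{dom}\varphi_{N_C})=\{x\in X\mid \varphi_{N_C}(x,0)=0\}=\{x\in X\mid \varphi_{N_C}(x,0)\le 0\}=D(N_C^{+}).$$
   Context: $\langle x,x^*\rangle:=x^*(x)$ for $x\in X$, $x^*\in X^*$. Multi-valued operators $T:X\rightrightarrows X^*$ are identified with their graphs $\operatorname{Graph}T=\{(x,x^* )\in X\times X^*\mid x^*\in T(x)\}$, and $D(T)=\{x\in X\mid T(x)\ne\emptyset\}$. Conventions: $\sup\emptyset=-\infty$, $\inf\emptyset=+\infty$, $\infty-\infty=\infty$. For $C\subset X$: the indicator function is $\iota_C(x)=0$ if $x\in C$ and $\iota_C(x)=+\infty$ if $x\in X\setminus C$; the support function is $\sigma_C(x^* )=\sup\{\langle x,x^*\rangle\mid x\in C\}$, $x^*\in X^*$; the normal cone $N_C:X\rightrightarrows X^*$ is given by $N_C(a)=\{a^*\in X^*\mid \langle y-a,a^*\rangle\le 0\ \forall y\in C\}$ if $a\in C$ and $N_C(a)=\emptyset$ if $a\notin C$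 (this is the convex subdifferential of $\iota_C$). The portable hull of $C$ is $C^{\#}:=\{x\in X\mid \forall (a,a^* )\in\operatorname{Graph}N_C,\ \langle x-a,a^*\rangle\le 0\}$. The Fitzpatrick function of $T:X\rightrightarrows X^*$ is $\varphi_T:X\times X^*\to\overline{\mathbb{R}}$, $\varphi_T(x,x^* )=\sup\{\langle x-a,a^*\rangle+\langle a,x^*\rangle\mid (a,a^* )\in\operatorname{Graph}T\}$. $\operatorname{dom}\varphi_T=\{(x,x^* )\mid\varphi_T(x,x^* )<\infty\}$ and $\operatorname{Pr}_X$ is the projection of $X\times X^*$ onto $X$. The operator $T^{+}:X\rightrightarrows X^*$ has graph $\{(x,x^* )\mid \varphi_T(x,x^* )\le\langle x,x^*\rangle\}$, i.e. the set of $(x,x^* )$ with $\langle x-a,x^*-a^*\rangle\ge 0$ for all $(a,a^* )\in\operatorname{Graph}T$. *)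

(* Defs.v *)
From HB Require Import structures.
From mathcomp Require Import all_boot all_order all_algebra.
From mathcomp Require Import all_classical all_reals all_analysis.

Set Implicit Arguments.
Unset Strict Implicit.
Unset Printing Implicit Defensive.

Import Order.TTheory GRing.Theory Num.Theory.
Import numFieldNormedType.Exports.

Local Open Scope classical_set_scope.
Local Open Scope ring_scope.

(* [tvsType R] includes local convexity but not the Hausdorff property. *)
Record topdual (R : realType) (X : tvsType R) := TopDual {
  topdual_fun :> {scalar X};
  topdual_continuous : continuous (topdual_fun : X -> R)
}.

Section Operators.
Context {R : realType} {X : tvsType R}.
Implicit Types (C : set X) (x a : X) (u b : topdual X).

Lemma topdual0_continuous : continuous ((\0 : {scalar X}) : X -> R).
Proof. exact: cst_continuous. Qed.

Definition topdual0 : topdual X := TopDual topdual0_continuous.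

Definition pairing x u : R := u x.

Definition operator := X -> set (topdual X).

Implicit Type T : operator.

Definition graph T : set (X * topdual X) := [set p | T p.1 p.2].

Definition op_dom T : set X := [set x | T x !=set0].

Definition indicator C x : \bar R := if x \in C then 0%E else +oo%E.

(* [ereal_sup set0 = -oo], here and in [fitzpatrick]. *)
Definition support_fun C u : \bar R :=
  ereal_sup [set (pairing x u)%:E | x in C].

Definition normal_cone C : operator :=
  fun a => [set b | C a /\ forall y, C y -> pairing (y - a) b <= 0].

Definition portable_hull C : set X :=
  [set x | forall a b, graph (normal_cone C) (a, b) ->
     pairing (x - a) b <= 0].

Definition fitzpatrick T (p : X * topdual X) : \bar R :=
  ereal_sup [set (pairing (p.1 - q.1) q.2 + pairing q.1 p.2)%:E
            | q in graph T].

(* Effective domain: the value [-oo] is allowed. *)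
Definition eff_dom (f : X * topdual X -> \bar R) : set (X * topdual X) :=
  [set p | (f p < +oo)%E].

Definition op_plus T : operator :=
  fun x => [set u | (fitzpatrick T (x, u) <= (pairing x u)%:E)%E].

End Operators.

Arguments operator {R} X.

(* Main.v *)
Require Import Defs.
From HB Require Import structures.
From mathcomp Require Import all_boot all_order all_algebra.
From mathcomp Require Import all_classical all_reals all_analysis.

Import Order.TTheory GRing.Theory Num.Theory.
Import numFieldNormedType.Exports.

Local Open Scope classical_set_scope.
Local Open Scope ring_scope.

(** Two features of the graph of [normal_cone C] carry the formula.  The values
    of [normal_cone C] are cones, so the term [pairing (x - a) b] of the
    Fitzpatrick function can be multiplied by any [k >= 0] while
    [pairing a u] stays fixed: as soon as one such term is positive, which
    means that [x] is outside the portable hull, the supremum is [+oo]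
    ([fitzpatrick_normal_cone_out]).  And the zero functional is normal to [C]
    at each of its points, so the supremum is at least [support_fun C u],
    while inside the hull the terms [pairing (x - a) b] are nonpositive, so it
    is at most that ([fitzpatrick_normal_cone_in]).

    For nonempty [C] the support function vanishes at [0], and [C] always lies
    in its portable hull.  Each remaining assertion is read off from these
    facts: a value of the Fitzpatrick function below [+oo] at some [(x, u)]
    already forces [x] into the hull ([fitzpatrick_normal_cone_lty]), and for
    [x] in the hull the functional [u = 0] witnesses membership in the
    projection of the effective domain and in the domain of
    [op_plus (normal_cone C)]. *)

Section DualScaling.
Local Set Implicit Arguments.
Local Unset Strict Implicit.
Context {R : realType} {X : tvsType R}.
Variables (k : R) (b : topdual X).

Definition scale_topdual_fun (x : X) : R := k * b x.

Lemma scale_topdual_linear : linear_for *%R scale_topdual_fun.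
Proof.
by move=> c x y; rewrite /scale_topdual_fun linearP/= mulrDr mulrCA.
Qed.

HB.instance Definition _ :=
  GRing.isLinear.Build R X R *%R scale_topdual_fun scale_topdual_linear.

Lemma scale_topdual_continuous :
  continuous ((scale_topdual_fun : {scalar X}) : X -> R).
Proof.
by move=> x; apply: cvgM; [exact: cvg_cst|exact: topdual_continuous].
Qed.

Definition scale_topdual : topdual X := TopDual scale_topdual_continuous.

Lemma pairingZ x : pairing x scale_topdual = k * pairing x b.
Proof. by []. Qed.

End DualScaling.

Section NormalCone.
Import constructive_ereal.DualAddTheory.
Local Set Implicit Arguments.
Local Unset Strict Implicit.
Context {R : realType} {X : tvsType R}.
Implicit Types (C : set X) (x a : X) (u b : topdual X).

Lemma pairing0 x : pairing x topdual0 = 0 :> R.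
Proof. by []. Qed.

Lemma normal_coneZ C a b (k : R) :
  0 <= k -> normal_cone C a b -> normal_cone C a (scale_topdual k b).
Proof.
move=> k0 [Ca Nb]; split=> // y Cy.
by rewrite pairingZ mulr_ge0_le0// Nb.
Qed.

Lemma normal_cone0 C a : C a -> normal_cone C a topdual0.
Proof. by move=> Ca; split=> // y _; rewrite pairing0. Qed.

Lemma sub_portable_hull C : C `<=` portable_hull C.
Proof. by move=> x Cx a b [_]; apply. Qed.

Lemma indicator_in C x : C x -> indicator C x = 0%E.
Proof. by move=> Cx; rewrite /indicator mem_set. Qed.

Lemma indicator_out C x : ~ C x -> indicator C x = +oo%E.
Proof. by move=> nCx; rewrite /indicator memNset. Qed.

Lemma indicator_ge0 C x : (0 <= indicator C x)%E.
Proof. by rewrite /indicator; case: ifP => // _; rewrite leey. Qed.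

Lemma support_fun0 C : C !=set0 -> support_fun C topdual0 = 0%E.
Proof.
move=> [a Ca]; apply/eqP; rewrite eq_le; apply/andP; split.
  by apply: ge_ereal_sup => _ [y Cy <-]; rewrite pairing0.
by apply: ereal_sup_ubound; exists a; rewrite ?pairing0.
Qed.

(** Inside the hull a nonzero normal [b] at [a] never does better than the
    pair [(a, topdual0)], whose term is [pairing a u]. *)
Lemma fitzpatrick_normal_cone_in C x u : portable_hull C x ->
  fitzpatrick (normal_cone C) (x, u) = support_fun C u.
Proof.
move=> hx; apply/eqP; rewrite eq_le; apply/andP; split.
  apply: ge_ereal_sup => _ [[a b] Nab <-] /=.
  apply: (@le_trans _ _ (pairing a u)%:E).
    by rewrite lee_fin gerDr (hx _ _ Nab).
  by apply: ereal_sup_ubound; exists a => //; case: Nab.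
apply: ge_ereal_sup => _ [a Ca <-]; apply: ereal_sup_ubound.
by exists (a, topdual0); [exact: normal_cone0|rewrite /= pairing0 add0r].
Qed.

(** A single normal direction that separates [x] from [C] is enough, because
    all its nonnegative multiples are normal at the same point. *)
Lemma fitzpatrick_normal_cone_out C x u : ~ portable_hull C x ->
  fitzpatrick (normal_cone C) (x, u) = +oo%E.
Proof.
move=> nhx.
have [a [b [Nab xab]]] :
    exists a b, normal_cone C a b /\ 0 < pairing (x - a) b.
  apply: contrapT => noab; apply: nhx => a b Nab.
  by rewrite leNgt; apply/negP => xab; apply: noab; exists a, b.
apply/eqyP => M _.
(* The scale [k] is chosen so that [k * pairing (x - a) b + pairing a u]
   reaches the prescribed bound [M]. *)
pose k := `|M - pairing a u| / pairing (x - a) b.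
have k0 : 0 <= k by rewrite divr_ge0// ltW.
apply: (@le_trans _ _ (k * pairing (x - a) b + pairing a u)%:E).
  by rewrite lee_fin divfK ?gt_eqF// -lerBlDr ler_norm.
apply: ereal_sup_ubound.
by exists (a, scale_topdual k b); first exact: normal_coneZ.
Qed.

(** The empty set is covered: its hull is all of [X], the operator has an
    empty graph, and both sides are [-oo]. *)
Lemma fitzpatrick_normal_coneE C x u :
  fitzpatrick (normal_cone C) (x, u)
    = (indicator (portable_hull C) x + support_fun C u)%dE.
Proof.
have [hx|nhx] := pselect (portable_hull C x).
  by rewrite indicator_in// dadd0e fitzpatrick_normal_cone_in.
by rewrite indicator_out// daddye fitzpatrick_normal_cone_out.
Qed.

Lemma fitzpatrick_normal_cone0 C x : C !=set0 ->
  fitzpatrick (normal_cone C) (x, topdual0) = indicator (portable_hull C) x.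
Proof.
by move=> C0; rewrite fitzpatrick_normal_coneE support_fun0// dadde0.
Qed.

(** On [C] the bound is an equality, because [C] lies in its hull; off [C] the
    dual addition makes the right-hand side [+oo], even when [C] is empty and the
    support function is [-oo]. *)
Lemma fitzpatrick_normal_cone_le C x u :
  (fitzpatrick (normal_cone C) (x, u)
     <= (indicator C x + support_fun C u)%dE)%E.
Proof.
have [Cx|nCx] := pselect (C x); last by rewrite indicator_out// daddye leey.
rewrite indicator_in// dadd0e fitzpatrick_normal_cone_in//.
exact: sub_portable_hull.
Qed.

Lemma fitzpatrick_normal_cone_lty C x u :
  (fitzpatrick (normal_cone C) (x, u) < +oo)%E -> portable_hull C x.
Proof.
by move=> fin; apply: contrapT => /(@fitzpatrick_normal_cone_out _ _ u) foo;
  rewrite foo ltxx in fin.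
Qed.

Lemma fitzpatrick_normal_cone00 C x : C !=set0 -> portable_hull C x ->
  fitzpatrick (normal_cone C) (x, topdual0) = 0%E.
Proof. by move=> C0 hx; rewrite fitzpatrick_normal_cone0// indicator_in. Qed.

End NormalCone.

(* [%dE] is the addition of extended reals with [+oo - oo = +oo]. *)
Theorem theorem1 (R : realType) (X : tvsType R)
    (hX : hausdorff_space X) (ntX : exists v : X, v <> 0) :
  (forall (C : set X) (x : X) (u : topdual X),
     fitzpatrick (normal_cone C) (x, u)
       = (indicator (portable_hull C) x + support_fun C u)%dE)
  /\
  (forall C : set X, C !=set0 ->
     (forall (x : X) (u : topdual X),
        [/\ fitzpatrick (normal_cone C) (x, topdual0)
              = indicator (portable_hull C) x,
            (0 <= indicator (portable_hull C) x)%E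
          & (fitzpatrick (normal_cone C) (x, u)
              <= (indicator C x + support_fun C u)%dE)%E])
     /\
     [/\ portable_hull C = fst @` eff_dom (fitzpatrick (normal_cone C)),
         portable_hull C
           = [set x | fitzpatrick (normal_cone C) (x, topdual0) = 0%E],
         portable_hull C
           = [set x | (fitzpatrick (normal_cone C) (x, topdual0) <= 0)%E]
       & portable_hull C = op_dom (op_plus (normal_cone C))]).
Proof.
split=> [C x u|C C0]; first exact: fitzpatrick_normal_coneE.
split=> [x u|].
  split; [exact: fitzpatrick_normal_cone0|exact: indicator_ge0|].
  exact: fitzpatrick_normal_cone_le.
have f00 x := @fitzpatrick_normal_cone00 _ _ C x C0.
have flty := @fitzpatrick_normal_cone_lty _ _ C.
split; apply/seteqP; split=> x /=.
- by move=> hx; exists (x, topdual0) => //; rewrite /eff_dom/= f00.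
- by move=> [[y u] fin <-]; exact: flty fin.
- exact: f00.
- by move=> f0; apply: (flty _ topdual0); rewrite f0.
- by move=> hx; rewrite f00.
- by move=> f0; apply: (flty _ topdual0); exact: le_lt_trans f0 _.
- by move=> hx; exists topdual0; rewrite /op_plus/= f00.
- by move=> [u xu]; apply: (flty _ u); exact: le_lt_trans xu (ltry _).
Qed.
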